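(* For all integers $k > 2$, there exists a Sperner $k$-partition system on a set of $2k+2$ elements with exactly $2k+1$ partitions.
   Context: A $k$-partition of a finite set $X$ is a collection of exactly $k$ pairwise disjoint non-empty subsets of $X$ (called classes) whose union is $X$. A Sperner $k$-partition system on $X$ is a set $\mathcal{P}$ of $k$-partitions of $X$ such that for any two distinct partitions $P, Q \in \mathcal{P}$, no class of $P$ is a subset of (in particular, equal to) a class of $Q$. *)

(* Defs.v *)
From mathcomp Require Import all_boot.
Set Implicit Arguments.
Unset Strict Implicit.
Unset Printing Implicit Defensive.

(* [partition] already requires the classes to be pairwise disjoint, non-empty
   and to cover the whole set. *)
Definition kpartition (X : finType) (k : nat) (P : {set {set X}}) : bool :=
  partition P [set: X] && (#|P| == k).

Definition sperner_kpartition_system (X : finType) (k : nat)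
    (S : {set {set {set X}}}) : Prop :=
  (forall P, P \in S -> kpartition k P) /\
  (forall P Q, P \in S -> Q \in S -> P != Q ->
     forall A B, A \in P -> B \in Q -> ~~ (A \subset B)).

(* Main.v *)
Require Import Defs.
From mathcomp Require Import all_boot zify.
Set Implicit Arguments.
Unset Strict Implicit.
Unset Printing Implicit Defensive.

(** Put n = 2k + 1 and view the 2k + 2 points as the residues modulo n
    together with a point at infinity, encoded by the number n.  The system
    consists of the n translates, under x |-> x + t with infinity fixed, of the
    single k-partition

      {0, 2, -2}, {1, 3, -3}, {infinity, -1}, {4, -4}, {5, -5}, ..., {k, -k}.

    It comes from the classical 1-factorization of the complete graph on 2k + 2
    points, whose base factor is {infinity, 0} and the pairs {i, -i}: there the
    pair {i, -i} has difference 2i, so the pairs realise each difference (up to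
    sign) once, and every pair of points lies in one translate only.  Here the
    pairs with differences 2, 4, 6 are given up, and their six points together
    with 0 are regrouped into two triples and a partner for infinity.  All
    differences inside the triples are again among 2, 4, 6 up to sign: they are
    2, 2, 4 in the first and 2, 4, 6 in the second.  Hence no remaining pair
    fits in a triple of a translate, the two triples are not translates of each
    other, and no nonzero translation fixes a class.  So a class of a translate
    lies in a class of another one only if the two translates coincide
    ([colour_rigid], [translate_nested]); in particular the n translates are
    distinct.

    Each partition is handled as the family of fibres of a colouring by
    0, ..., k - 1, and the comparison of classes becomes linear arithmetic on
    natural numbers. *)

(** * Partitions into the fibres of a colouring *)

Definition fibres (X : finType) (k : nat) (f : X -> nat) : {set {set X}} :=
  [set [set x | f x == i] | i : 'I_k].

Lemma kpartition_fibres (X : finType) (k : nat) (f : X -> nat) :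
    (forall x, f x < k) -> (forall i, i < k -> exists x, f x = i) ->
  kpartition k (fibres k f).
Proof.
move=> f_lt f_onto; apply/andP; split; first (apply/and3P; split).
- apply/eqP/setP=> x; rewrite inE; apply/bigcupP.
  exists [set y | f y == f x]; last by rewrite inE.
  by apply/imsetP; exists (Ordinal (f_lt x)).
- apply/trivIsetP=> _ _ /imsetP[i _ ->] /imsetP[j _ ->] neq_ij.
  rewrite -setI_eq0; apply/eqP/setP=> x; rewrite !inE.
  by apply: contraNF neq_ij => /andP[/eqP <- /eqP <-].
- apply/imsetP=> -[i _ /setP].
  by have [x fx] := f_onto _ (ltn_ord i) => /(_ x); rewrite !inE fx eqxx.
- rewrite card_imset ?card_ord // => i j /setP.
  have [x fx] := f_onto _ (ltn_ord i) => /(_ x); rewrite !inE fx eqxx.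
  by move/esym/eqP/val_inj.
Qed.

(** * The base colouring and its translates *)

(** The residue - i is written n - i.  The pair {i, -i} with 3 < i <= k gets
    colour i - 1, so that the colours used are exactly 0, ..., k - 1. *)
Definition colour (n x : nat) : nat :=
  if [|| x == 0, x == 2 | x == n - 2] then 0
  else if [|| x == 1, x == 3 | x == n - 3] then 1
  else if (x == n - 1) || (x == n) then 2
  else (minn x (n - x)).-1.

(** Translation by d < n modulo n; the reduction is a single subtraction rather
    than a remainder, which keeps it piecewise linear. *)
Definition shift (n d x : nat) : nat :=
  if x == n then n else if x + d < n then x + d else x + d - n.

(** Together with [shiftE], the form of the definitions on which the case
    analyses below rely. *)
Lemma colourE (n x : nat) :
  (x = 0 \/ x = 2 \/ x = n - 2) /\ colour n x = 0 \/
  (x = 1 \/ x = 3 \/ x = n - 3) /\ colour n x = 1 \/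
  (x = n - 1 \/ x = n) /\ colour n x = 2 \/
  3 < x /\ (x < n - 3 \/ n < x) /\ colour n x = (minn x (n - x)).-1.
Proof. by rewrite /colour; do 3?[case: ifP => ?]; lia. Qed.

Lemma shiftE (n d x : nat) :
  x = n /\ shift n d x = n \/
  x <> n /\ x + d < n /\ shift n d x = x + d \/
  x <> n /\ n <= x + d /\ shift n d x = x + d - n.
Proof. by rewrite /shift; do 2?[case: ifP => ?]; lia. Qed.

Lemma colour_lt (k n x : nat) :
  2 < k -> n = 2 * k + 1 -> x <= n -> colour n x < k.
Proof. by have := colourE n x; lia. Qed.

Lemma colour_onto (k n i : nat) :
    2 < k -> n = 2 * k + 1 -> i < k ->
  exists2 u, u <= n & colour n u = i.
Proof.
move=> hk hn lt_ik.
exists (if i < 2 then i else if i == 2 then n else i.+1).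
  by do 2?[case: ifP => ?]; lia.
have := colourE n (if i < 2 then i else if i == 2 then n else i.+1).
by do 2?[case: ifP => ?]; lia.
Qed.

Lemma shift_le (n d x : nat) : d < n -> x <= n -> shift n d x <= n.
Proof. by have := shiftE n d x; lia. Qed.

Lemma shift_onto (n d u : nat) :
  d < n -> u <= n -> exists2 x, x <= n & shift n d x = u.
Proof.
move=> lt_dn le_un.
pose x := if u == n then n else if u < d then u + n - d else u - d.
have shift_x := shiftE n d x.
by exists x; move: shift_x; rewrite /x; do 2?[case: ifP => ?]; lia.
Qed.

(** The witness is s - t modulo n. *)
Lemma shift_diff (n t s : nat) :
    t < n -> s < n ->
  exists d, [/\ d < n, d = 0 -> t = s &
    forall x, x <= n -> shift n s x = shift n d (shift n t x)].
Proof.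
move=> lt_tn lt_sn; exists (if t <= s then s - t else s + n - t).
case: ifP => le_ts; split; try lia; move=> x le_xn.
  have := shiftE n s x; have := shiftE n t x.
  by have := shiftE n (s - t) (shift n t x); lia.
have := shiftE n s x; have := shiftE n t x.
by have := shiftE n (s + n - t) (shift n t x); lia.
Qed.

(** * No nonzero translation maps a class into a class *)

Ltac split_fact H :=
  match type of H with
  | _ \/ _ => destruct H as [H | H]; [split_fact H | split_fact H]
  | _ /\ _ =>
      let H' := fresh in destruct H as [H' H]; split_fact H'; split_fact H
  | _ => idtac
  end.

(** Adds one disjunctive fact and keeps only its consistent alternatives.  Used
    on one fact after the other it leaves few cases, whereas the product of all
    the disjunctions is far too large for a single call to the decision
    procedure. *)
Ltac by_cases fact :=
  let H := fresh in have H := fact; split_fact H; try (exfalso; lia).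

Lemma rigid_triple0 (k n d : nat) :
    2 < k -> n = 2 * k + 1 -> d < n ->
    colour n (shift n d 2) = colour n (shift n d 0) ->
    colour n (shift n d (n - 2)) = colour n (shift n d 0) ->
  d = 0.
Proof.
move=> hk hn lt_dn eq2 eqN2.
by_cases (shiftE n d 0).
all: by_cases (colourE n (shift n d 0)).
all: by_cases (shiftE n d 2).
all: by_cases (colourE n (shift n d 2)).
all: by_cases (shiftE n d (n - 2)).
all: by_cases (colourE n (shift n d (n - 2))).
all: lia.
Qed.

Lemma rigid_triple1 (k n d : nat) :
    2 < k -> n = 2 * k + 1 -> d < n ->
    colour n (shift n d 3) = colour n (shift n d 1) ->
    colour n (shift n d (n - 3)) = colour n (shift n d 1) ->
  d = 0.
Proof.
move=> hk hn lt_dn eq3 eqN3.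
by_cases (shiftE n d 1).
all: by_cases (colourE n (shift n d 1)).
all: by_cases (shiftE n d 3).
all: by_cases (colourE n (shift n d 3)).
all: by_cases (shiftE n d (n - 3)).
all: by_cases (colourE n (shift n d (n - 3))).
all: lia.
Qed.

Lemma rigid_infinity (k n d : nat) :
    2 < k -> n = 2 * k + 1 -> d < n ->
    colour n (shift n d (n - 1)) = colour n (shift n d n) ->
  d = 0.
Proof.
move=> hk hn lt_dn eqN1.
by_cases (shiftE n d n).
all: by_cases (colourE n (shift n d n)).
all: by_cases (shiftE n d (n - 1)).
all: by_cases (colourE n (shift n d (n - 1))).
all: lia.
Qed.

Lemma rigid_pair (k n d i : nat) :
    2 < k -> n = 2 * k + 1 -> d < n -> 3 < i <= k ->
    colour n (shift n d (n - i)) = colour n (shift n d i) ->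
  d = 0.
Proof.
move=> hk hn lt_dn bd_i eqNi.
by_cases (shiftE n d i).
all: by_cases (colourE n (shift n d i)).
all: by_cases (shiftE n d (n - i)).
all: by_cases (colourE n (shift n d (n - i))).
all: lia.
Qed.

(** In each class two or three points already decide: the class of i.+1 and its
    opposite, the partner of infinity, or the three points of a triple cannot be
    moved onto points of one colour by a nonzero translation. *)
Lemma colour_rigid (k n d i j : nat) :
    2 < k -> n = 2 * k + 1 -> d < n -> i < k ->
    (forall u, u <= n -> colour n u = i -> colour n (shift n d u) = j) ->
  d = 0.
Proof.
move=> hk hn lt_dn lt_ik sub_ij.
have mono u v : u <= n -> v <= n -> colour n u = i -> colour n v = i ->
    colour n (shift n d u) = colour n (shift n d v).
  by move=> ? ? ? ?; rewrite !sub_ij.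
have [i0|[i1|[i2|gt2i]]] : i = 0 \/ i = 1 \/ i = 2 \/ 2 < i by lia.
- have col0 u : u = 0 \/ u = 2 \/ u = n - 2 -> colour n u = i.
    by have := colourE n u; lia.
  by apply: (rigid_triple0 hk hn lt_dn); apply: mono; try apply: col0; lia.
- have col1 u : u = 1 \/ u = 3 \/ u = n - 3 -> colour n u = i.
    by have := colourE n u; lia.
  by apply: (rigid_triple1 hk hn lt_dn); apply: mono; try apply: col1; lia.
- have col2 u : u = n - 1 \/ u = n -> colour n u = i.
    by have := colourE n u; lia.
  by apply: (rigid_infinity hk hn lt_dn); apply: mono; try apply: col2; lia.
- apply: (@rigid_pair k n d i.+1 hk hn lt_dn); first lia.
  apply: mono; try lia.
    by have := colourE n (n - i.+1); lia.
  by have := colourE n i.+1; lia.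
Qed.

(** * The system of translates *)

Definition translate (k t : nat) : {set {set 'I_(2 * k + 2)}} :=
  fibres k (fun x : 'I_(2 * k + 2) =>
    colour (2 * k + 1) (shift (2 * k + 1) t x)).

Lemma translate_point (k t u : nat) :
    t < 2 * k + 1 -> u <= 2 * k + 1 ->
  exists x : 'I_(2 * k + 2), shift (2 * k + 1) t x = u.
Proof.
move=> lt_t le_u; have [x le_x <-] := shift_onto lt_t le_u.
have lt_x : x < 2 * k + 2 by lia.
by exists (Ordinal lt_x).
Qed.

Lemma kpartition_translate (k t : nat) :
  2 < k -> t < 2 * k + 1 -> kpartition k (translate k t).
Proof.
move=> hk lt_t; apply: kpartition_fibres => [x|i lt_ik].
  by apply: colour_lt => //; apply: shift_le => //; have := ltn_ord x; lia.
have [u le_u <-] := colour_onto hk (erefl _) lt_ik.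
by have [x <-] := translate_point lt_t le_u; exists x.
Qed.

(** Seen in the coordinates that make the first partition the base one, the
    second is its translate by the difference of s and t, so that
    [colour_rigid] forces this difference to vanish. *)
Lemma translate_nested (k t s : nat) (A B : {set 'I_(2 * k + 2)}) :
    2 < k -> t < 2 * k + 1 -> s < 2 * k + 1 ->
    A \in translate k t -> B \in translate k s -> A \subset B ->
  t = s.
Proof.
move=> hk lt_t lt_s /imsetP[i _ ->] /imsetP[j _ ->] /subsetP sub_ij.
have [d [lt_d d0 shiftD]] := shift_diff lt_t lt_s.
apply/d0/(@colour_rigid k _ d i j hk (erefl _) lt_d) => // u le_u col_u.
have [x shift_x] := translate_point lt_t le_u.
have := sub_ij x; rewrite !inE shiftD ?shift_x; last by have := ltn_ord x; lia.
by rewrite col_u eqxx => /(_ isT)/eqP.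
Qed.

Theorem theorem4p1 (k : nat) (hk : 2 < k) :
  exists S : {set {set {set 'I_(2 * k + 2)}}},
    sperner_kpartition_system k S /\ #|S| = 2 * k + 1.
Proof.
exists [set translate k t | t : 'I_(2 * k + 1)]; split; first split.
- by move=> _ /imsetP[t _ ->]; apply: kpartition_translate.
- move=> _ _ /imsetP[t _ ->] /imsetP[s _ ->] neq_ts A B inA inB.
  apply: contraNN neq_ts => subAB.
  by rewrite (translate_nested hk (ltn_ord t) (ltn_ord s) inA inB subAB).
- rewrite card_imset ?card_ord // => t s eq_ts; apply: val_inj.
  (* A class common to both partitions is nested in itself. *)
  have k_gt0 : 0 < k by lia.
  pose A := [set x : 'I_(2 * k + 2) |
    colour (2 * k + 1) (shift (2 * k + 1) t x) == 0].
  have inA : A \in translate k t by apply/imsetP; exists (Ordinal k_gt0).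
  apply: (translate_nested hk (ltn_ord t) (ltn_ord s) inA _ (subxx A)).
  by rewrite -eq_ts.
Qed.
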